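(* Let $A$ be an $S$-algebra, let $m$ be a positive integer and let $\phi$ be a derivation on $A$. Assume that $HH^2(A)=0$. Then there exists a formal automorphism on $A$ of the form $$\Phi_t=1+t^m\phi+t^{m+1}\phi_{m+1}+t^{m+2}\phi_{m+2}+\cdots.$$
   Context: An exponential sequence is a sequence $\alpha=(\alpha_1,\alpha_2,\ldots)$ of non-negative integers with all but finitely many $\alpha_i$ equal to $0$; sums are componentwise; $\mathcal{E}$ is the set of all exponential sequences. The Landweber-Novikov algebra $S$ is the associative ring with underlying free abelian group $S=\bigoplus_{\alpha\in\mathcal{E}}\mathbf{Z}s_\alpha$, whose product is composition of the Landweber-Novikov operations $s_\alpha$ on complex cobordism; its unit is $s_{(0,0,\ldots)}$. (Concretely, $S$ can be realized under composition as the ring of additive operators on $\mathbf{Z}[x_1,x_2,\ldots]$ with basis the $s_\alpha$ determined by $\sum_\alpha s_\alpha(f)\,b_1^{\alpha_1}b_2^{\alpha_2}\cdots=f(x_1+\sum_n b_nx_1^{n+1},\,x_2+\sum_n b_nx_2^{n+1},\ldots)$.) An $S$-algebra is a commutative ring $A$ with $1$ equipped with an $S$-module structure satisfying the Cartan formula $s_\alpha(ab)=\sum_{\beta+\gamma=\alpha}s_\beta(a)s_\gamma(b)$ for all $\alpha\in\mathcal{E}$, $a,b\in A$. $\mathrm{End}(A)$ is the ring of additive self-maps of $A$ under composition. A derivation on $A$ is an additive map $f\colon A\to A$ with $f(ab)=af(b)+f(a)b$. A formal automorphism on $A$ is a formal power series $\Phi_t=1+t\phi_1+t^2\phi_2+\cdots$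 with $1=\mathrm{Id}_A$ and all $\phi_i\in\mathrm{End}(A)$, satisfying $\Phi_t(ab)=\Phi_t(a)\Phi_t(b)$ as power series for all $a,b\in A$ (equivalently $\phi_n(ab)=\sum_{i=0}^n\phi_i(a)\phi_{n-i}(b)$ for all $n\ge0$, with $\phi_0=1$). $HH^2(A)$ is the second Hochschild cohomology group of $A$ as an algebra over $\mathbf{Z}$ with coefficients in $A$, computed from the standard complex $C^n(A,A)=\mathrm{Hom}_{\mathbf Z}(A^{\otimes n},A)$ (tensor products over $\mathbf{Z}$) with the usual Hochschild differential. *)

(* Defs.v *)
From HB Require Import structures.
From mathcomp Require Import all_boot all_order all_algebra generic_quotient finmap.
From mathcomp.multinomials Require Import monalg.
From mathcomp Require Import boolp functions.

Set Implicit Arguments.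
Unset Strict Implicit.
Unset Printing Implicit Defensive.

Import Order.TTheory GRing.Theory Num.Theory.

Local Open Scope ring_scope.

Definition endo (V : zmodType) : Type := {additive V -> V}.

Section EndoRing.
Variable V : zmodType.
Implicit Types f g h : endo V.

Lemma endoP f g : (forall x, f x = g x) -> f = g.
Proof.
case: f g => [f fP] [g gP] /= /funext fg.
case: _ / fg in gP *; congr GRing.Additive.Pack.
by case: fP gP => [[p]] [[q]]; rewrite (Prop_irrelevance p q).
Qed.

HB.instance Definition _ := gen_eqMixin (endo V).
HB.instance Definition _ := gen_choiceMixin (endo V).

Definition endo0 : endo V := (\0 : V -> V)%R.
Definition endo1 : endo V := idfun.
Definition endo_opp f : endo V := (\- f)%R.
Definition endo_add f g : endo V := (f \+ g)%R.
Definition endo_comp f g : endo V := f \o g.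

Fact endo_addA : associative endo_add.
Proof. by move=> f g h; apply/endoP => x; apply: addrA. Qed.
Fact endo_addC : commutative endo_add.
Proof. by move=> f g; apply/endoP => x; apply: addrC. Qed.
Fact endo_add0 : left_id endo0 endo_add.
Proof. by move=> f; apply/endoP => x; apply: add0r. Qed.
Fact endo_addN : left_inverse endo0 endo_opp endo_add.
Proof. by move=> f; apply/endoP => x; apply: addNr. Qed.

HB.instance Definition _ :=
  GRing.isZmodule.Build (endo V) endo_addA endo_addC endo_add0 endo_addN.

Fact endo_compA : associative endo_comp.
Proof. by move=> f g h; apply/endoP. Qed.
Fact endo_comp1l : left_id endo1 endo_comp.
Proof. by move=> f; apply/endoP. Qed.
Fact endo_comp1r : right_id endo1 endo_comp.
Proof. by move=> f; apply/endoP. Qed.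
Fact endo_compDl : left_distributive endo_comp +%R.
Proof. by move=> f g h; apply/endoP. Qed.
Fact endo_compDr : right_distributive endo_comp +%R.
Proof. by move=> f g h; apply/endoP => x; apply: raddfD. Qed.

HB.instance Definition _ := GRing.Zmodule_isPzRing.Build (endo V)
  endo_compA endo_comp1l endo_comp1r endo_compDl endo_compDr.

Lemma endo0E x : (0 : endo V) x = 0. Proof. by []. Qed.
Lemma endo1E x : (1 : endo V) x = x. Proof. by []. Qed.
Lemma endoDE f g x : (f + g) x = f x + g x. Proof. by []. Qed.
Lemma endoNE f x : (- f) x = - f x. Proof. by []. Qed.
Lemma endoME f g x : (f * g) x = f (g x). Proof. by []. Qed.

End EndoRing.

Section MonomialEval.
Variables (I : choiceType) (R : comNzRingType) (v : I -> R).

Definition cmeval (m : {cmonom I}) : R := \prod_(i <- finsupp m) v i ^+ m i.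

Lemma cmevalEw (d : {fset I}) (m : {cmonom I}) : (finsupp m `<=` d)%fset ->
  cmeval m = \prod_(i <- d) v i ^+ m i.
Proof.
move=> le_md; rewrite /cmeval (big_fset_incl _ le_md) // => i _ /fsfun_dflt ->.
by rewrite expr0.
Qed.

Lemma cmeval_mmorphism : mmorphism cmeval.
Proof.
split=> [m1 m2|]; last by rewrite /cmeval mdom1 big_seq_fset0.
rewrite (@cmevalEw (finsupp m1 `|` finsupp m2)%fset) ?mdomD //.
rewrite (cmevalEw (fsubsetUl _ (finsupp m2))) (cmevalEw (fsubsetUr (finsupp m1) _)).
by rewrite -big_split /=; apply: eq_bigr => i _; rewrite cmM exprD.
Qed.

HB.instance Definition _ :=
  isMultiplicative.Build {cmonom I} R cmeval cmeval_mmorphism.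

Lemma cmevalU i : cmeval (ucm i) = v i.
Proof. by rewrite /cmeval mdomU big_seq_fset1 cmUU expr1. Qed.

End MonomialEval.

Section PolyEval.
Variables (I : choiceType) (R : nzRingType) (S : comNzRingType).
Variables (f : {rmorphism R -> S}) (v : I -> S).

Definition peval : {malg R[{cmonom I}]} -> S := mmap f (cmeval v).

HB.instance Definition _ := GRing.RMorphism.copy peval (mmap f (cmeval v)).

Lemma pevalU c m : peval << c *g m >> = f c * cmeval v m.
Proof. exact: mmapU. Qed.
Lemma pevalC c : peval c%:MP = f c.
Proof. exact: mmapC. Qed.
Lemma pevalX i : peval << ucm i >> = v i.
Proof. by rewrite pevalU rmorph1 mul1r cmevalU. Qed.

End PolyEval.

Lemma cmonom_ind (I : choiceType) (P : {cmonom I} -> Prop) :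
  P mone -> (forall i m, P m -> P (mmul (ucm i) m)) -> forall m, P m.
Proof.
move=> P1 PM m; have [n] := ubnP (mdeg m); elim: n m => // n IHn m /ltnSE le_m.
have [->//|m_neq1] := eqVneq m mone.
have [i mi] : exists i, m i != 0%N.
  apply: contrapT => m0; case/eqP: m_neq1; apply/eqP/cmP => i.
  by rewrite cm1; apply: contrapT => /eqP mi; apply: m0; exists i.
have mE : m = mmul (ucm i) (divcm m (ucm i)).
  apply/eqP/cmP => j; rewrite cmM divcmE ucmE.
  by case: (eqVneq i j) mi => [<-|_ _]; [case: (m i) => // k; rewrite subn1|rewrite subn0].
rewrite mE; apply/PM/IHn; move: le_m; rewrite {1}mE mdegM mdegU.
by [].
Qed.

(* Indices are shifted by one: [n : nat] stands for the index n+1.  A monomial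
   in variables indexed by [nat] is a finitely supported family of exponents,
   i.e. an exponential sequence; [mmul] adds the exponents and [mone] is the
   sequence (0, 0, ...). *)
Notation expseq := {cmonom nat}.

(* Polynomial rings R[X_0, X_1, ...], axiomatized so that the computations below
   are done over an opaque carrier; the only instance used is [malg_mp]. *)
Record mpring (R : comNzRingType) := MPRing {
  mp_sort :> comNzRingType;
  mpC : {rmorphism R -> mp_sort};
  mpX : nat -> mp_sort;
  mpM : expseq -> mp_sort;
  mpc : expseq -> {additive mp_sort -> R};
  mp_supp : mp_sort -> {fset expseq};
  mp_ev : forall S : comNzRingType,
    {rmorphism R -> S} -> (nat -> S) -> {rmorphism mp_sort -> S};
  mpM1 : mpM mone = 1;
  mpMU : forall i m, mpM (mmul (ucm i) m) = mpX i * mpM m;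
  mpE : forall p, p = \sum_(m <- mp_supp p) mpC (mpc m p) * mpM m;
  mpcE : forall m n c, mpc m (mpC c * mpM n) = c *+ (n == m);
  mp_supp0 : forall m p, m \notin mp_supp p -> mpc m p = 0;
  mp_evC : forall S f v c, @mp_ev S f v (mpC c) = f c;
  mp_evX : forall S f v i, @mp_ev S f v (mpX i) = v i
}.

Arguments mpc {R P} m : rename.

Section MPRingTheory.
Variables (R : comNzRingType) (P : mpring R).
Local Notation C := (mpC P).
Local Notation X := (mpX P).
Local Notation M := (mpM P).
Local Notation c_ := (@mpc R P).

Lemma mpME m : M m = cmeval X m.
Proof.
elim/cmonom_ind: m => [|i m IHm]; first by rewrite mpM1 (cmeval_mmorphism X).2.
by rewrite mpMU IHm (cmeval_mmorphism X).1 cmevalU.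
Qed.

Lemma mpMM m n : M (mmul m n) = M m * M n.
Proof. by rewrite !mpME (cmeval_mmorphism X).1. Qed.

Lemma mpMX i : M (ucm i) = X i.
Proof. by rewrite mpME cmevalU. Qed.

Lemma mp_evM (S : comNzRingType) (f : {rmorphism R -> S}) v m :
  mp_ev P f v (M m) = cmeval v m.
Proof.
rewrite mpME /cmeval rmorph_prod; apply: eq_bigr => i _.
by rewrite rmorphXn mp_evX.
Qed.

Lemma mp_ext (S : comNzRingType) (f g : {rmorphism P -> S}) :
  (forall c, f (C c) = g (C c)) -> (forall i, f (X i) = g (X i)) ->
  forall p, f p = g p.
Proof.
move=> fgC fgX p; rewrite (mpE p) !rmorph_sum; apply: eq_bigr => m _.
rewrite !rmorphM fgC; congr (_ * _); rewrite mpME /cmeval !rmorph_prod.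
by apply: eq_bigr => i _; rewrite !rmorphXn fgX.
Qed.

Lemma mpc_sum m p : c_ m p = \sum_(n <- mp_supp p) c_ n p *+ (n == m).
Proof.
rewrite [in LHS](mpE p) raddf_sum; apply: eq_bigr => n _.
by rewrite mpcE.
Qed.

Lemma mpcMl m c p : c_ m (C c * p) = c * c_ m p.
Proof.
rewrite (mpc_sum m p) [in LHS](mpE p) !mulr_sumr raddf_sum.
by apply: eq_bigr => n _; rewrite mulrA -rmorphM mpcE mulrnAr.
Qed.

Lemma mpcC m c : c_ m (C c) = c *+ (mone == m).
Proof. by rewrite -(mpcE P) mpM1 mulr1. Qed.

Lemma mpc_mul m p q : c_ m (p * q) = \sum_(k <- mp_supp p) \sum_(l <- mp_supp q)
  (c_ k p * c_ l q) *+ (mmul k l == m).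
Proof.
rewrite {1}(mpE p) {1}(mpE q) mulr_suml raddf_sum; apply: eq_bigr => k _.
rewrite mulr_sumr raddf_sum; apply: eq_bigr => l _.
by rewrite mulrACA -rmorphM -mpMM mpcE.
Qed.

Section Kill.
Variable e : {fset nat}.

Definition mp_kill : {rmorphism P -> P} :=
  mp_ev P C (fun n => if n \in e then X n else 0).

Lemma mp_killM m : mp_kill (M m) = if (finsupp m `<=` e)%fset then M m else 0.
Proof.
elim/cmonom_ind: m => [|i m IHm]; first by rewrite mpM1 rmorph1 mdom1 fsub0set.
rewrite mpMU rmorphM IHm mp_evX mdomD fsubUset mdomU fsub1set.
by case: (i \in e); rewrite ?mul0r //=; case: ifP; rewrite ?mulr0.
Qed.

Lemma mpc_kill m p : c_ m (mp_kill p) = if (finsupp m `<=` e)%fset then c_ m p else 0.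
Proof.
rewrite [in LHS](mpE p) rmorph_sum raddf_sum mpc_sum.
have -> : (if (finsupp m `<=` e)%fset then
   \sum_(n <- mp_supp p) c_ n p *+ (n == m) else 0) =
   \sum_(n <- mp_supp p) (if (finsupp m `<=` e)%fset then c_ n p *+ (n == m) else 0).
  by case: ifP => // _; rewrite big1.
apply: eq_bigr => n _; rewrite rmorphM mp_evC mp_killM.
case: (eqVneq n m) => [->|nm]; first by case: ifP => _; rewrite ?mpcE ?eqxx ?mulr0 ?raddf0.
by rewrite mulr0n if_same; case: ifP => _; rewrite ?mpcE ?(negPf nm) ?mulr0 ?raddf0.
Qed.
End Kill.

End MPRingTheory.

Section PolyMap.
Variables (R S : comNzRingType) (f : {rmorphism R -> S}) (P : mpring R) (Q : mpring S).

Definition mp_map : {rmorphism P -> Q} := mp_ev P (mpC Q \o f) (mpX Q).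

Lemma mp_mapC c : mp_map (mpC P c) = mpC Q (f c). Proof. exact: mp_evC. Qed.
Lemma mp_mapX i : mp_map (mpX P i) = mpX Q i. Proof. exact: mp_evX. Qed.
Lemma mp_mapM m : mp_map (mpM P m) = mpM Q m.
Proof. by rewrite mp_evM mpME. Qed.

Lemma mpc_map m p : mpc m (mp_map p) = f (mpc m p).
Proof.
rewrite (mpc_sum m p) {1}(mpE p) !rmorph_sum raddf_sum; apply: eq_bigr => n _.
by rewrite rmorphM mp_mapC mp_mapM mpcE rmorphMn.
Qed.
End PolyMap.

(* all beta with beta i <= alpha i for every i *)
Definition below (alpha : expseq) : {fset expseq} :=
  [fset [cmonom (g i : nat) | i : finsupp alpha]%M
     | g : {dffun forall i : finsupp alpha, 'I_(alpha (val i)).+1} in predT]%fset.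

Lemma belowP (alpha beta : expseq) : reflect (forall i, beta i <= alpha i)%N (beta \in below alpha).
Proof.
apply: (iffP (imfsetP _ _ _ _)) => [[g _ ->] i|le_ba].
  rewrite cmE fsfun_ffun; case: insubP => [j _ <-|] //=.
  by rewrite -ltnS ltn_ord.
exists [ffun i : finsupp alpha => inord (beta (val i)) : 'I_(alpha (val i)).+1] => //.
apply/eqP/cmP => i; rewrite cmE fsfun_ffun; case: insubP => [j _ <-|] /=.
  by rewrite ffunE inordK // ltnS.
rewrite memNfinsupp => /eqP a0; move: (le_ba i); rewrite a0 leqn0 => /eqP //.
Qed.

Lemma mul_below (alpha beta gamma : expseq) :
  mmul beta gamma = alpha -> (beta \in below alpha) /\ (gamma \in below alpha).
Proof.
by move=> <-; split; apply/belowP => i; rewrite cmM ?leq_addr ?leq_addl.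
Qed.

Section Closure.
Variables (ZX : mpring int) (ZXB : mpring ZX).

Definition a_total (d : {fset nat}) : {rmorphism ZX -> ZXB} :=
  mp_ev ZX (intmul 1)
    (fun i => mpC ZXB (mpX ZX i)
              + \sum_(n <- d) mpC ZXB (mpX ZX i ^+ n.+2) * mpX ZXB n).

Definition a_ln (alpha : expseq) (f : ZX) : ZX :=
  mpc alpha (a_total (finsupp alpha) f).

Lemma a_totalX d i : a_total d (mpX ZX i) =
  mpC ZXB (mpX ZX i) + \sum_(n <- d) mpC ZXB (mpX ZX i ^+ n.+2) * mpX ZXB n.
Proof. exact: mp_evX. Qed.

Lemma a_killX e i : mp_kill ZXB e (mpX ZXB i) = if i \in e then mpX ZXB i else 0.
Proof. exact: mp_evX. Qed.

Lemma a_killC e c : mp_kill ZXB e (mpC ZXB c) = mpC ZXB c.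
Proof. exact: mp_evC. Qed.

Lemma kill_total e d f : (e `<=` d)%fset ->
  mp_kill ZXB e (a_total d f) = a_total e f.
Proof.
move=> le_ed.
apply: (mp_ext (f := mp_kill ZXB e \o a_total d) (g := a_total e)) => [c|i].
  by rewrite /= !mp_evC rmorph_int.
rewrite /= !a_totalX rmorphD a_killC; congr (_ + _).
rewrite rmorph_sum -(big_fset_incl _ le_ed) /=; last first.
  by move=> n _ ne; rewrite rmorphM a_killX (negPf ne) mulr0.
apply: eq_big_seq => n ne.
by rewrite rmorphM a_killC a_killX ne.
Qed.

Lemma mpc_total alpha d f : mpc alpha (a_total d f) =
  if (finsupp alpha `<=` d)%fset then a_ln alpha f else 0.
Proof.
rewrite -{1}(kill_total f (fsubset_refl d)) mpc_kill; case: ifP => // le_ad.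
by rewrite /a_ln -(kill_total f le_ad) mpc_kill fsubset_refl.
Qed.

Lemma a_ln1 f : a_ln mone f = f.
Proof.
have totC : a_total (finsupp (mone : expseq)) f = mpC ZXB f.
  apply: (mp_ext (g := mpC ZXB)) f => [c|i].
    by rewrite mp_evC -[in RHS](intz c) !rmorph_int.
  by rewrite a_totalX mdom1 big_seq_fset0 addr0.
by rewrite /a_ln totC mpcC eqxx mulr1n.
Qed.

Variables (Z1 : mpring int) (W0 : mpring Z1) (W : mpring ZXB).
Variable d : {fset nat}.

Let io1 : {rmorphism Z1 -> ZXB} := mp_map (intmul 1 : {rmorphism int -> ZX}) Z1 ZXB.
Let io : {rmorphism W0 -> W} := mp_map io1 W0 W.
Let Psi : {rmorphism ZX -> W} := mp_map (a_total d) ZXB W \o a_total d.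

Lemma mpc_Psi (alpha beta : expseq) f : (finsupp alpha `<=` d)%fset -> (finsupp beta `<=` d)%fset ->
  mpc alpha (mpc beta (Psi f)) = a_ln alpha (a_ln beta f).
Proof. by move=> da db; rewrite /= mpc_map !mpc_total da db. Qed.

Lemma mpc_io (alpha beta : expseq) w : mpc alpha (mpc beta (io w)) = (mpc alpha (mpc beta w))%:~R.
Proof. by rewrite !mpc_map. Qed.

Let av n : W0 := mpC W0 (mpX Z1 n).
Let bv n : W0 := mpX W0 n.
Let q : {poly W0} := \sum_(n <- d) av n *: 'X^n.
Let A : {poly W0} := 'X + 'X^2 * q.
Let r : {poly W0} := q + \sum_(n <- d) bv n *: ('X^n * (1 + 'X * q) ^+ n.+2).

Lemma r_def : 'X + 'X^2 * r = A + \sum_(n <- d) bv n *: A ^+ n.+2.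
Proof.
rewrite /r mulrDr addrA -/A; congr (_ + _); rewrite mulr_sumr.
apply: eq_bigr => n _; rewrite -scalerAr mulrA -exprD add2n.
have -> : A = 'X * (1 + 'X * q) by rewrite /A mulrDr mulr1 mulrA expr2.
by rewrite exprMn.
Qed.

Lemma av_io n : io (av n) = mpC W (mpX ZXB n).
Proof. by rewrite /io mp_mapC mp_mapX. Qed.
Lemma bv_io n : io (bv n) = mpX W n.
Proof. exact: mp_mapX. Qed.

Lemma ev_exists (y : W) : exists ev : {poly W0} -> W,
  [/\ {morph ev : p q / p + q}, {morph ev : p q / p * q},
      forall n, {morph ev : p / p ^+ n}, ev 'X = y & forall c p, ev (c *: p) = io c * ev p].
Proof.
pose ev : {rmorphism {poly W0} -> W} := horner_eval y \o map_poly io.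
exists ev; split=> [p p1|p p1|n p||c p]; rewrite ?rmorphD ?rmorphM ?rmorphXn //=.
  by rewrite map_polyX /horner_eval hornerX.
by rewrite /= map_polyZ /horner_eval hornerZ.
Qed.

Lemma ev_sum (ev : {poly W0} -> W) (s : seq nat) F :
  {morph ev : p q / p + q} -> ev (\sum_(n <- s) F n) = \sum_(n <- s) ev (F n).
Proof.
move=> evD; apply: (big_morph ev evD).
by apply: (addrI (ev 0)); rewrite -evD !addr0.
Qed.

Lemma Psi_X i (ev : {poly W0} -> W) :
  {morph ev : p q / p + q} -> {morph ev : p q / p * q} ->
  (forall n, {morph ev : p / p ^+ n}) ->
    ev 'X = mpC W (mpC ZXB (mpX ZX i)) -> (forall c p, ev (c *: p) = io c * ev p) ->
  Psi (mpX ZX i) = ev ('X + 'X^2 * r).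
Proof.
set x := mpX ZX i; set y := mpC W _ => evD evM evXn evX evZ.
have evA : ev A = mpC W (a_total d x).
  rewrite /A /q evD evM evXn (ev_sum _ _ evD) evX a_totalX rmorphD rmorph_sum /=.
  congr (_ + _); rewrite mulr_sumr; apply: eq_bigr => n _.
  rewrite evZ evXn evX av_io rmorphM !rmorphXn -/y.
  by rewrite mulrCA -exprD add2n mulrC.
rewrite r_def evD (ev_sum _ _ evD) evA.
rewrite [LHS]/= a_totalX rmorphD rmorph_sum mp_mapC -a_totalX; congr (_ + _).
apply: eq_bigr => n _.
rewrite evZ bv_io evXn evA.
by rewrite rmorphM mp_mapC mp_mapX !rmorphXn mulrC.
Qed.

Let K : {fset nat} := [fset n in iota 0 (size r)]%fset.

Let Theta : {rmorphism ZXB -> W} :=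
  mp_ev ZXB (mpC W \o mpC ZXB) (fun n => io r`_n).

Lemma Psi_Theta f : Psi f = Theta (a_total K f).
Proof.
apply: (mp_ext (g := Theta \o a_total K)) f => [c|i].
  by rewrite /= !mp_evC !rmorph_int.
have [ev [evD evM evXn evX evZ]] := ev_exists (mpC W (mpC ZXB (mpX ZX i))).
rewrite (Psi_X evD evM evXn evX evZ); move: evX; set x := mpX ZX i; set y := mpC W _ => evX.
rewrite [RHS]/= a_totalX rmorphD rmorph_sum evD evM evXn evX.
rewrite mp_evC; congr (_ + _).
rewrite -{1}[r]coefK poly_def -(big_mkord xpredT (fun n => r`_n *: 'X^n)) (ev_sum _ _ evD) mulr_sumr.
rewrite [RHS](perm_big (index_iota 0 (size r))); last first.
  apply: uniq_perm; rewrite ?iota_uniq ?fset_uniq // => n.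
  by rewrite !inE /index_iota subn0.
apply: eq_bigr => n _.
rewrite evZ evXn evX rmorphM mp_evX mp_evC mulrCA -exprD add2n mulrC.
by rewrite /= !rmorphXn.
Qed.

Let coefT (alpha beta gamma : expseq) : int :=
  mpc alpha (mpc beta (cmeval (fun n => r`_n) gamma)).

Lemma mpc_Theta (alpha beta : expseq) g : mpc alpha (mpc beta (Theta g)) =
  \sum_(gamma <- mp_supp g) mpc gamma g *~ coefT alpha beta gamma.
Proof.
rewrite {1}(mpE g) rmorph_sum !raddf_sum; apply: eq_bigr => gamma _.
rewrite rmorphM mp_evC mp_evM [X in X * _]/= !mpcMl -mulrzr; congr (_ * _).
have -> : cmeval (fun n => io r`_n) gamma = io (cmeval (fun n => r`_n) gamma).
  by rewrite /cmeval rmorph_prod; apply: eq_bigr => n _; rewrite rmorphXn.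
exact: mpc_io.
Qed.

Definition lowdeg k (w : W0) := forall alpha beta : expseq,
  (mdeg alpha + mdeg beta < k)%N -> mpc alpha (mpc beta w) = 0.

Lemma lowdeg_mul j k v w : lowdeg j v -> lowdeg k w -> lowdeg (j + k) (v * w).
Proof.
move=> vj wk alpha beta ltab; rewrite mpc_mul raddf_sum big1 // => b1 _.
rewrite raddf_sum big1 // => b2 _; case: eqP => [b12|_]; last by rewrite raddf0.
rewrite mulr1n mpc_mul big1 // => a1 _; rewrite big1 // => a2 _.
case: eqP => // a12; rewrite mulr1n.
move: ltab; rewrite -b12 -a12 !mdegM addnACA => ltab.
case: (ltnP (mdeg a1 + mdeg b1) j) => [lt1|le1]; first by rewrite vj ?mul0r.
by rewrite wk ?mulr0 // -(ltn_add2l j) (leq_ltn_trans _ ltab) // leq_add2r.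
Qed.

Let eps1 : {rmorphism Z1 -> int} := mp_ev Z1 idfun (fun _ => 0).
Let eps : {rmorphism W0 -> int} := mp_ev W0 eps1 (fun _ => 0).

Lemma mp_ev0 (R S : comNzRingType) (P : mpring R) (f : {rmorphism R -> S}) p :
  mp_ev P f (fun _ => 0) p = f (mpc mone p).
Proof.
rewrite mpc_sum {1}(mpE p) !rmorph_sum; apply: eq_bigr => m _.
rewrite rmorphM mp_evC mp_evM rmorphMn; case: eqVneq => [->|m1].
  by rewrite (cmeval_mmorphism _).2 mulr1.
rewrite mulr0n; elim/cmonom_ind: m m1 => [/eqP//|i m _ _].
by rewrite (cmeval_mmorphism _).1 cmevalU mul0r mulr0.
Qed.

Lemma epsE w : eps w = mpc mone (mpc mone w).
Proof. by rewrite /eps mp_ev0 /eps1 mp_ev0. Qed.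

Lemma eps_r n : eps r`_n = 0.
Proof.
have Z c p : eps c = 0 -> map_poly eps (c *: p) = 0.
  by move=> c0; rewrite map_polyZ [X in X *: _]c0 scale0r.
rewrite -coef_map; suff -> : map_poly eps r = 0 by rewrite coef0.
rewrite /r /q rmorphD !rmorph_sum [X in X + _]big1 => [|k _].
  rewrite add0r big1 // => k _; apply: Z; exact: mp_evX.
by apply: Z; rewrite /av [LHS]mp_evC; exact: mp_evX.
Qed.

Lemma lowdeg_r n : lowdeg 1 r`_n.
Proof.
move=> alpha beta; rewrite ltnS leqn0 addn_eq0 !mdeg_eq0 => /andP[/eqP-> /eqP->].
by rewrite -epsE eps_r.
Qed.

Lemma lowdeg_cmeval gamma : lowdeg (mdeg gamma) (cmeval (fun n => r`_n) gamma).
Proof.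
elim/cmonom_ind: gamma => [|n m IHm]; first by move=> a b; rewrite mdeg1.
by rewrite (cmeval_mmorphism _).1 cmevalU mdegM mdegU; apply: lowdeg_mul (lowdeg_r _) IHm.
Qed.

Lemma a_ln_comp_aux (alpha beta : expseq) :
  (finsupp alpha `<=` d)%fset -> (finsupp beta `<=` d)%fset ->
  exists (F : {fset expseq}) (c : expseq -> int),
  forall f, a_ln alpha (a_ln beta f) = \sum_(gamma <- F) a_ln gamma f *~ c gamma.
Proof.
move=> ad bd; pose D := (mdeg alpha + mdeg beta)%N.
exists (below [cmonom D | _ in K]%M), (coefT alpha beta) => f.
rewrite -(mpc_Psi f ad bd) Psi_Theta mpc_Theta; set g := a_total K f.
set F := below _; pose G := (F `|` mp_supp g)%fset.
have FK gamma : gamma \in F -> (finsupp gamma `<=` K)%fset.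
  move/belowP => leF; apply/fsubsetP => i; apply: contraLR => iK.
  by move: (leF i); rewrite cmE fsfun_fun (negPf iK) leqn0 memNfinsupp.
rewrite (big_fset_incl _ (fsubsetUr F (mp_supp g))); last first.
  by move=> gamma _ /mp_supp0 ->; rewrite mul0rz.
rewrite -(big_fset_incl _ (fsubsetUl F (mp_supp g))) => [|gamma].
  by apply: eq_big_seq => gamma /FK gK; rewrite mpc_total gK.
rewrite mpc_total; case: ifP => [gK|_]; last by rewrite mul0rz.
move=> _ gF; rewrite /coefT lowdeg_cmeval ?mulr0z //.
rewrite ltnNge; apply: contra gF => le_gD; apply/belowP => i.
rewrite cmE fsfun_fun; case: ifP => [iK|iK].
  apply: leq_trans le_gD; rewrite mdegE.
  case: (boolP (i \in finsupp gamma)) => [ig|]; last by rewrite memNfinsupp => /eqP->.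
  by rewrite (big_fsetD1 i) //= leq_addr.
by rewrite leqn0 -memNfinsupp; apply: contraFN iK; apply: (fsubsetP gK).
Qed.
End Closure.

Section Free.
Variables (ZX : mpring int) (ZXB : mpring ZX).

Lemma cmonom_seq (m : expseq) : exists s : seq nat,
  m = \big[mmul/mone]_(i <- s) ucm i.
Proof.
elim/cmonom_ind: m => [|i m [s ->]]; first by exists [::]; rewrite big_nil.
by exists (i :: s); rewrite big_cons.
Qed.

Section Exps.
Variables N K : nat.
Implicit Types e : {ffun 'I_N -> 'I_K.+1}.

Definition xexp e : expseq :=
  \big[mmul/mone]_(i < N) iter (e i).+1 (mmul (@ucm nat i)) mone.
Definition bexp e : expseq :=
  \big[mmul/mone]_(i < N) (if e i : nat is k.+1 then ucm k else mone).

Lemma xexpE e (i : 'I_N) : xexp e (i : nat) = (e i).+1.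
Proof.
have itE j n k : iter n (mmul (@ucm nat j)) mone k = ((j == k) * n)%N.
  by elim: n => [|n IHn]; rewrite ?cm1 ?muln0 //= cmM IHn cmU mulnS.
rewrite /xexp (big_morph (fun m : expseq => m (i : nat)) (fun m n => cmM (i : nat) m n) (cm1 (i : nat))).
rewrite (bigD1 i) // itE eqxx mul1n big1 => [|j ji]; first exact: addn0.
by rewrite itE; move: ji; rewrite -val_eqE /= => /negPf ->.
Qed.

Lemma xexp_inj : injective xexp.
Proof.
move=> e1 e2 e12; apply/ffunP => i; apply/val_inj/succn_inj.
by rewrite -!xexpE e12.
Qed.

Lemma total_prod (f := \prod_(i < N) mpX ZX i) :
  a_total ZXB [fset n in iota 0 K]%fset f =
  \sum_e mpC ZXB (mpM ZX (xexp e)) * mpM ZXB (bexp e).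
Proof.
rewrite rmorph_prod /=.
have XE (i : 'I_N) : a_total ZXB [fset n in iota 0 K]%fset (mpX ZX i) =
    \sum_(k < K.+1) mpC ZXB (mpX ZX i ^+ k.+1) *
      mpM ZXB (if k : nat is n.+1 then ucm n else mone).
  rewrite a_totalX big_ord_recl /= mpM1 mulr1 expr1; congr (_ + _).
  rewrite (perm_big (index_iota 0 K)); last first.
    apply: uniq_perm; rewrite ?iota_uniq ?fset_uniq // => n.
    by rewrite !inE /index_iota subn0.
  by rewrite big_mkord; apply: eq_bigr => n _; rewrite mpMX.
rewrite (eq_bigr _ (fun i _ => XE i)) bigA_distr_bigA /=.
apply: eq_bigr => e _; rewrite big_split /= -rmorph_prod; congr (mpC _ _ * _).
  rewrite (big_morph _ (mpMM ZX) (mpM1 ZX)); apply: eq_bigr => i _.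
  by elim: (_.+1) => [|n IHn]; rewrite ?mpM1 //= mpMU -IHn exprS.
by rewrite (big_morph _ (mpMM ZXB) (mpM1 ZXB)).
Qed.
End Exps.

Lemma a_ln_free (F : {fset expseq}) (c : expseq -> int) :
  (forall f, \sum_(gamma <- F) a_ln (ZX:=ZX) ZXB gamma f *~ c gamma = 0) ->
  forall gamma, gamma \in F -> c gamma = 0.
Proof.
move=> sum0 gamma gF.
have [s sE] := cmonom_seq gamma.
pose K := (\max_(m <- F) \max_(i <- finsupp m) i.+1)%N.
pose N := size s; pose f := \prod_(i < N) mpX ZX i.
have FK m : m \in F -> (finsupp m `<=` [fset n in iota 0 K])%fset.
  move=> mF; apply/fsubsetP => i im; rewrite !inE mem_iota add0n leq0n /=.
  by apply: leq_trans (leq_bigmax_seq _ mF isT); apply: leq_trans (leq_bigmax_seq _ im isT).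
have lnE m : m \in F -> a_ln ZXB m f =
    \sum_(e : {ffun 'I_N -> 'I_K.+1}) mpM ZX (xexp e) *+ (bexp e == m).
  move=> mF; transitivity (mpc m (a_total ZXB [fset n in iota 0 K]%fset f)).
    by rewrite mpc_total FK.
  by rewrite total_prod raddf_sum; apply: eq_bigr => e _; rewrite mpcE.
have [e eE] : exists e : {ffun 'I_N -> 'I_K.+1}, bexp e = gamma.
  exists [ffun i : 'I_N => inord (nth 0%N s i).+1].
  rewrite sE (big_nth 0%N) big_mkord; apply: eq_bigr => i _.
  rewrite ffunE inordK // ltnS.
  have : nth 0%N s i \in finsupp gamma.
    rewrite sE (big_nth 0%N) big_mkord (bigD1 i) //= -cmE_neq0 cmM cmUU //.
  by move/(fsubsetP (FK _ gF)); rewrite !inE mem_iota.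
have := congr1 (mpc (xexp e)) (sum0 f); rewrite raddf0 raddf_sum.
rewrite (bigD1_seq gamma) ?fset_uniq //= [X in _ + X]big_seq_cond big1 => [|m /andP[mF mg]].
  rewrite addr0 lnE // raddfMz raddf_sum (bigD1 e) //= big1 => [|e' e'e].
    by rewrite addr0 eE eqxx mulr1n -[mpM _ _]mul1r -(rmorph1 (mpC ZX)) mpcE eqxx mulr1n -mulrzr mul1r intz.
  rewrite raddfMn -[mpM _ _]mul1r -(rmorph1 (mpC ZX)) mpcE.
  by case: eqP => [/xexp_inj/eqP|_]; rewrite ?(negPf e'e) //= mulr0n mul0rn.
rewrite lnE // raddfMz raddf_sum big1 ?mul0rz // => e' _.
rewrite raddfMn -[mpM _ _]mul1r -(rmorph1 (mpC ZX)) mpcE.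
case: eqP => [/xexp_inj->|_]; last by rewrite mulr0n mul0rn.
by rewrite eE eq_sym (negPf mg) mulr0n.
Qed.
End Free.

Section MalgMPRing.
Variable R : comNzRingType.
Local Notation P := {malg R[expseq]}.

Fact malg_mpMU i (m : expseq) : << mmul (ucm i) m >> = << ucm i >> * << m >> :> P.
Proof. by rewrite malgM_def fgmulUU mulr1. Qed.

Fact malg_mpCM (c : R) (m : expseq) : c%:MP * << m >> = << c *g m >> :> P.
Proof. by rewrite malgM_def fgmulUU mulr1 mul1m. Qed.

Fact malg_mpE (p : P) : p = \sum_(m <- msupp p) (p@_m)%:MP * << m >>.
Proof.
by rewrite {1}(monalgE p); apply: eq_bigr => m _; exact: esym (malg_mpCM _ _).
Qed.

Fact malg_mpcE (m n : expseq) (c : R) : (c%:MP * << n >> : P)@_m = c *+ (n == m).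
Proof. by rewrite malg_mpCM mcoeffU. Qed.

Definition malg_mp : mpring R :=
  @MPRing R P (@malgC expseq R) (fun i => << ucm i >>) (fun m => << m >>)
    (@mcoeff expseq R) msupp (@peval nat R) (erefl _) malg_mpMU malg_mpE
    malg_mpcE (fun m p => @mcoeff_outdom expseq R p m) (@pevalC nat R) (@pevalX nat R).
End MalgMPRing.

Notation zx := {malg int[expseq]}.
Notation zxb := {malg zx[expseq]}.

Definition zx_var (i : nat) : zx := << ucm i >>.

(* f |-> f(x_i + sum_(n in d) b_n x_i^(n+1)) (unshifted indices).  The series
   with all the b_n is truncated to n in d, which affects only the coefficients
   of monomials involving some b_n with n not in d: see [ln_op_total]. *)
Definition total_op (d : {fset nat}) : {rmorphism zx -> zxb} :=
  peval (intmul 1) (fun i =>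
    (zx_var i)%:MP + \sum_(n <- d) (zx_var i ^+ n.+2)%:MP * << ucm n >>).

(* the coefficient of b^alpha *)
Definition ln_op (alpha : expseq) : endo zx :=
  (mcoeff alpha \o total_op (finsupp alpha) : {additive zx -> zx}).

Definition malg_zxb : mpring (malg_mp int) := malg_mp zx.

Lemma ln_opE alpha f : ln_op alpha f = a_ln malg_zxb alpha f.
Proof. exact: erefl. Qed.

Lemma ln_op_total alpha d f :
  (total_op d f)@_alpha = if (finsupp alpha `<=` d)%fset then ln_op alpha f else 0.
Proof. exact: (@mpc_total _ malg_zxb alpha d f). Qed.

Definition ln_comb (c : {malg int[expseq]}) : endo zx :=
  \sum_(alpha <- msupp c) ln_op alpha *~ c@_alpha.

Definition ln_span : {pred endo zx} := fun f => `[< exists c, f = ln_comb c >].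

Lemma ln_combEw (c : {malg int[expseq]}) (F : {fset expseq}) :
  (msupp c `<=` F)%fset -> ln_comb c = \sum_(alpha <- F) ln_op alpha *~ c@_alpha.
Proof.
move=> le_cF; rewrite /ln_comb (big_fset_incl _ le_cF) // => alpha _ /mcoeff_outdom ->.
by rewrite mulr0z.
Qed.

Lemma endo_sumE (V : zmodType) I (r : seq I) (F : I -> endo V) x :
  (\sum_(i <- r) F i) x = \sum_(i <- r) F i x.
Proof. exact: (big_morph (fun f : endo V => f x)). Qed.

Lemma endo_mulzE (V : zmodType) (f : endo V) (z : int) x : (f *~ z) x = f x *~ z.
Proof.
have natE n : (f *+ n) x = f x *+ n.
  by elim: n => [|n IHn]; rewrite ?mulr0n // !mulrS endoDE IHn.
by case: z => n; rewrite -?pmulrn ?NegzE ?mulrNz ?endoNE -?pmulrn natE.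
Qed.

Lemma ln_op_in alpha : ln_op alpha \in ln_span.
Proof.
apply/asboolP; exists << alpha >>.
by rewrite (ln_combEw msuppU_le) big_seq_fset1 mcoeffUU.
Qed.

Lemma ln_op1 : ln_op mone = 1.
Proof. by apply/endoP => f; rewrite ln_opE a_ln1. Qed.

Lemma ln_op_comp alpha beta : exists (F : {fset expseq}) (c : expseq -> int),
  ln_op alpha * ln_op beta = \sum_(gamma <- F) ln_op gamma *~ c gamma.
Proof.
pose d := (finsupp alpha `|` finsupp beta)%fset.
have [F [c cE]] := a_ln_comp_aux (malg_mp (malg_mp int)) (malg_mp malg_zxb)
   (fsubsetUl _ _ : (finsupp alpha `<=` d)%fset) (fsubsetUr _ _).
exists F, c; apply/endoP => f; rewrite endoME endo_sumE !ln_opE cE.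
by apply: eq_bigr => gamma _; rewrite endo_mulzE ln_opE.
Qed.

Lemma ln_combB c1 c2 : ln_comb (c1 - c2) = ln_comb c1 - ln_comb c2.
Proof.
pose F := (msupp c1 `|` msupp c2)%fset.
rewrite (ln_combEw (fsubsetUl _ _ : (msupp c1 `<=` F)%fset)).
rewrite (ln_combEw (fsubsetUr _ _ : (msupp c2 `<=` F)%fset)).
rewrite (ln_combEw (msuppB_le c1 c2 : (_ `<=` F)%fset)) -sumrB.
by apply: eq_bigr => alpha _; rewrite mcoeffB mulrzBr.
Qed.

Lemma ln_span_zmod_closed : zmod_closed ln_span.
Proof.
split=> [|_ _ /asboolP[c1 ->] /asboolP[c2 ->]]; apply/asboolP.
  by exists 0; rewrite /ln_comb msupp0 big_seq_fset0.
by exists (c1 - c2); rewrite ln_combB.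
Qed.
HB.instance Definition _ := GRing.isZmodClosed.Build _ ln_span ln_span_zmod_closed.

Lemma ln_span_sum (F : {fset expseq}) (c : expseq -> int) :
  \sum_(gamma <- F) ln_op gamma *~ c gamma \in ln_span.
Proof. by apply: rpred_sum => gamma _; apply/rpredMz/ln_op_in. Qed.

Lemma ln_span_mulr_closed : mulr_closed ln_span.
Proof.
split=> [|_ _ /asboolP[c1 ->] /asboolP[c2 ->]].
  by rewrite -ln_op1; exact: ln_op_in.
rewrite mulr_suml; apply: rpred_sum => alpha _.
rewrite mulr_sumr; apply: rpred_sum => beta _.
rewrite mulrzAl mulrzAr; do 2!apply: rpredMz.
by have [F [c ->]] := ln_op_comp alpha beta; exact: ln_span_sum.
Qed.
Lemma ln_span_subring_closed : subring_closed ln_span.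
Proof.
by case: ln_span_mulr_closed ln_span_zmod_closed => ? ? [_ ?]; split.
Qed.

(* the Landweber-Novikov algebra S, free over Z on the s_alpha by [ln_basis] *)
Record LN : Type := MkLN { ln_val : endo zx; _ : ln_val \in ln_span }.

HB.instance Definition _ := [isSub for ln_val].
HB.instance Definition _ := [Choice of LN by <:].
HB.instance Definition _ :=
  GRing.SubChoice_isSubPzRing.Build _ _ LN ln_span_subring_closed.

Definition ln (alpha : expseq) : LN := MkLN (ln_op_in alpha).

Lemma ln_basis (x : LN) :
  exists! c : {malg int[expseq]}, x = \sum_(alpha <- msupp c) ln alpha *~ c@_alpha.
Proof.
have valE (c : {malg int[expseq]}) (F : {fset expseq}) :
    val (\sum_(alpha <- F) ln alpha *~ c@_alpha) = \sum_(alpha <- F) ln_op alpha *~ c@_alpha.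
  by rewrite raddf_sum; apply: eq_bigr => alpha _; rewrite raddfMz.
case: x => x xP; have /asboolP[c xE] := xP; exists c; split.
  by apply/val_inj; rewrite valE.
move=> c' /(congr1 val); rewrite valE /= xE => cc'.
apply/malgP => gamma; apply/eqP; rewrite -subr_eq0 -mcoeffB; apply/eqP.
have [gF|/mcoeff_outdom//] := boolP (gamma \in msupp (c - c')).
apply: (a_ln_free (ZXB := malg_zxb) (c := fun m => (c - c')@_m)) gF => f.
have comb0 : ln_comb (c - c') = 0.
  by rewrite ln_combB; apply/eqP; rewrite subr_eq0; apply/eqP.
transitivity (ln_comb (c - c') f); last by rewrite comb0.
rewrite /ln_comb endo_sumE; apply: eq_bigr => alpha _.
by rewrite endo_mulzE ln_opE.
Qed.

(* an S-module structure on the additive group of A is a ring morphism S -> End(A) *)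
HB.mixin Record ComPzRing_isSAlgebra A of GRing.ComPzRing A := {
  s_act : {rmorphism LN -> endo A};
  cartan : forall (alpha : expseq) (a b : A),
    s_act (ln alpha) (a * b) =
    \sum_(beta <- below alpha) \sum_(gamma <- below alpha | mmul beta gamma == alpha)
      s_act (ln beta) a * s_act (ln gamma) b
}.

#[short(type="sAlgType")]
HB.structure Definition SAlgebra :=
  {A of GRing.ComPzRing A & ComPzRing_isSAlgebra A}.

(* C^n(A, A) = Hom(A^{(x)n}, A) is represented by the maps of n arguments that are
   additive in each of them. *)
Section Hochschild.
Variable A : pzRingType.

Definition hupd n (v : {ffun 'I_n -> A}) (i : 'I_n) (a : A) : {ffun 'I_n -> A} :=
  [ffun j => if j == i then a else v j].

Definition multiadditive n (f : {ffun 'I_n -> A} -> A) : Prop :=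
  forall (v : {ffun 'I_n -> A}) (i : 'I_n) (a b : A),
    f (hupd v i (a + b)) = f (hupd v i a) + f (hupd v i b).

Definition hmerge n (i : 'I_n) (v : {ffun 'I_n.+1 -> A}) : {ffun 'I_n -> A} :=
  [ffun j : 'I_n => if (j < i)%N then v (lift ord_max j)
                    else if j == i then v (lift ord_max i) * v (lift ord0 i)
                    else v (lift ord0 j)].

(* a_0 f(a_1, ..., a_n) + sum_(0 <= i < n) (-1)^(i+1) f(..., a_i a_(i+1), ...)
   + (-1)^(n+1) f(a_0, ..., a_(n-1)) a_n; as a natural number, [lift ord0 j] is
   j+1 and [lift ord_max j] is j *)
Definition hdiff n (f : {ffun 'I_n -> A} -> A) (v : {ffun 'I_n.+1 -> A}) : A :=
  v ord0 * f [ffun j => v (lift ord0 j)]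
  + \sum_(i < n) (-1) ^+ i.+1 * f (hmerge i v)
  + (-1) ^+ n.+1 * (f [ffun j => v (lift ord_max j)] * v ord_max).

Lemma hdiffB n (f g : {ffun 'I_n -> A} -> A) v :
  hdiff (f - g) v = hdiff f v - hdiff g v.
Proof.
rewrite /hdiff [X in _ = _ + X]opprD [RHS]addrACA [X in _ = _ + X + _]opprD
        [X in _ = X + _]addrACA.
rewrite -sumrB -!mulrBr -mulrBl.
by congr (_ + _ + _); apply: eq_bigr => i _; rewrite -mulrBr.
Qed.

Lemma hdiff0 n v : hdiff (0 : {ffun 'I_n -> A} -> A) v = 0.
Proof. by rewrite -(subrr 0) hdiffB subrr. Qed.

Lemma multiadditive0 n : multiadditive (0 : {ffun 'I_n -> A} -> A).
Proof. by move=> v i a b; exact: esym (addr0 0). Qed.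

Lemma multiadditiveB n (f g : {ffun 'I_n -> A} -> A) :
  multiadditive f -> multiadditive g -> multiadditive (f - g).
Proof.
move=> fM gM v i a b.
transitivity (f (hupd v i (a + b)) - g (hupd v i (a + b))) => //.
by rewrite fM gM opprD addrACA.
Qed.

Definition hcocycle_pred n : {pred {ffun 'I_n -> A} -> A} :=
  fun f => `[< multiadditive f /\ forall v, hdiff f v = 0 >].

Fact hcocycle_zmod_closed n : zmod_closed (@hcocycle_pred n).
Proof.
split=> [|f g /asboolP[fM fZ] /asboolP[gM gZ]]; apply/asboolP; split.
- exact: multiadditive0.
- exact: hdiff0.
- exact: multiadditiveB.
- by move=> v; rewrite hdiffB fZ gZ subr0.
Qed.
HB.instance Definition _ n :=
  GRing.isZmodClosed.Build _ (@hcocycle_pred n) (@hcocycle_zmod_closed n).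

Record hcocycle n : Type :=
  HCocycle { hcocycle_val :> {ffun 'I_n -> A} -> A; _ : hcocycle_val \in @hcocycle_pred n }.
HB.instance Definition _ n := [isSub for @hcocycle_val n].
HB.instance Definition _ n := [Choice of hcocycle n by <:].
HB.instance Definition _ n :=
  GRing.SubChoice_isSubZmodule.Build _ _ (hcocycle n) (@hcocycle_zmod_closed n).
End Hochschild.

Section HochschildCohomology.
Variable A : pzRingType.

Definition hcoboundary_pred n : {pred hcocycle A n} :=
  match n return {pred hcocycle A n} with
  | 0 => fun f => f == 0
  | n'.+1 => fun f =>
      `[< exists2 g : {ffun 'I_n' -> A} -> A, multiadditive g &
            forall v, f v = hdiff g v >]
  end.

Fact hcoboundary_zmod_closed n : zmod_closed (@hcoboundary_pred n).
Proof.
case: n => [|n]; split=> [|f g].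
- exact: eqxx.
- by move=> /eqP-> /eqP->; rewrite subr0; exact: eqxx.
- apply/asboolP; exists 0; first exact: multiadditive0.
  by move=> v; rewrite hdiff0.
- move=> /asboolP[f' f'M fE] /asboolP[g' g'M gE]; apply/asboolP.
  exists (f' - g'); first exact: multiadditiveB.
  by move=> v; rewrite hdiffB -fE -gE.
Qed.
HB.instance Definition _ n :=
  GRing.isZmodClosed.Build _ (@hcoboundary_pred n) (@hcoboundary_zmod_closed n).

Definition HH n : zmodType := Quotient.quot (@hcoboundary_pred n).

End HochschildCohomology.

Definition derivation (A : pzRingType) (f : endo A) : Prop :=
  forall a b, f (a * b) = a * f b + f a * b.

Definition psmul (R : pzRingType) (f g : nat -> R) : nat -> R :=
  fun n => \sum_(i < n.+1) f i * g (n - i)%N.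

(* Phi n is the coefficient phi_n of t^n *)
Definition formal_automorphism (A : pzRingType) (Phi : nat -> endo A) : Prop :=
  Phi 0%N = 1 /\
  forall a b : A, (fun n => Phi n (a * b)) = psmul (fun n => Phi n a) (fun n => Phi n b).

(* Main.v *)
Require Import Defs.
From mathcomp Require Import all_boot all_order all_algebra.
From HB Require Import structures.
From mathcomp Require Import generic_quotient boolp.

(** For [P] a formal series of endomorphisms put [E(a,b) = P a * P b - P (a * b)].
    Associativity of the product of power series gives
    [P a * E(b,c) - E(ab,c) + E(a,bc) - E(a,b) * P c = 0].
    If [E] vanishes in degrees below [n] and [P] has constant term 1, then the
    coefficient of degree [n] of this identity says that the coefficient [E_n]
    is a Hochschild 2-cocycle.  As HH^2 = 0, [E_n] is the coboundary of an
    additive map [g], and subtracting [g] from the coefficient of degree [n] of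
    [P] kills [E_n] without affecting lower degrees.  Starting from
    [1 + t^m phi], which is multiplicative up to degree [m] because [phi] is a
    derivation, one iterates. *)

Set Implicit Arguments.
Unset Strict Implicit.
Unset Printing Implicit Defensive.

Import GRing.Theory.
Local Open Scope ring_scope.

Section PowerSeriesProduct.
Variable R : pzRingType.
Implicit Types f g h : nat -> R.

Lemma psmul_recl f g n :
  psmul f g n.+1 = f 0%N * g n.+1 + psmul (fun k => f k.+1) g n.
Proof. by rewrite /psmul big_ord_recl. Qed.

(** Induction on [n] for all [f] at once: the shift of [psmul f g] is [f 0] times the shift of [g],
    plus the product of the shifted [f] with [g]. *)
Lemma psmulA f g h n : psmul f (psmul g h) n = psmul (psmul f g) h n.
Proof.
elim: n f => [|n IHn] f; first by rewrite /psmul !big_ord1 mulrA.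
rewrite !psmul_recl IHn mulrDr mulrA -addrA [psmul f g 0]big_ord1; congr (_ + _).
rewrite /psmul mulr_sumr -big_split; apply: eq_bigr => i _.
by rewrite /= mulrA -mulrDl [in RHS]big_ord_recl.
Qed.

Lemma psmulBl f g h n :
  psmul (fun k => f k - g k) h n = psmul f h n - psmul g h n.
Proof. by rewrite /psmul -sumrB; apply: eq_bigr => i _; rewrite mulrBl. Qed.

Lemma psmulBr f g h n :
  psmul h (fun k => f k - g k) n = psmul h f n - psmul h g n.
Proof. by rewrite /psmul -sumrB; apply: eq_bigr => i _; rewrite mulrBr. Qed.

Lemma eq_psmul f f' g g' n :
    (forall k, (k <= n)%N -> f k = f' k) -> (forall k, (k <= n)%N -> g k = g' k) ->
  psmul f g n = psmul f' g' n.
Proof.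
by move=> ff' gg'; apply: eq_bigr => i _; rewrite ff' ?leq_ord ?gg' ?leq_subr.
Qed.

Lemma psmul_vanishr f g n : (forall k, (k < n)%N -> g k = 0) ->
  psmul f g n = f 0%N * g n.
Proof.
move=> g0; rewrite /psmul big_ord_recl subn0 big1 ?addr0 // => i _.
by rewrite g0 ?mulr0 // lift0 subnS prednK ?leq_subr // subn_gt0.
Qed.

Lemma psmul_vanishl f g n : (forall k, (k < n)%N -> f k = 0) ->
  psmul f g n = f n * g 0%N.
Proof.
move=> f0; rewrite /psmul big_ord_recr subnn /= big1 ?add0r // => i _.
by rewrite f0 ?mul0r.
Qed.

(** Isolates the two extreme terms, the only ones that involve coefficients of degree [n.+1]; the
    middle ones use degrees 1 to [n]. *)
Lemma psmul_recl_recr f g n :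
  psmul f g n.+1 = f 0%N * g n.+1 + \sum_(i < n) f i.+1 * g (n - i)%N + f n.+1 * g 0%N.
Proof. by rewrite /psmul big_ord_recl big_ord_recr /= subnn addrA. Qed.

End PowerSeriesProduct.

Section Obstruction.
Variable A : pzRingType.
Implicit Types (F G : nat -> endo A) (f : A -> A -> A).

(** Translates the vanishing of the quotient group into curried biadditive maps, so that cochains on
    finite functions do not appear later. *)
Lemma HH2_vanish f : (forall x : HH A 2, x = 0) ->
    (forall a a' b, f (a + a') b = f a b + f a' b) ->
    (forall a b b', f a (b + b') = f a b + f a b') ->
    (forall a b c, a * f b c - f (a * b) c + f a (b * c) - f a b * c = 0) ->
  exists g : endo A, forall a b, f a b = a * g b - g (a * b) + g a * b.
Proof.
move=> HH2_0 fDl fDr fZ.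
pose fc (v : {ffun 'I_2 -> A}) := f (v ord0) (v ord_max).
have fcP : fc \in @hcocycle_pred A 2.
  apply/asboolP; split=> [v i a b|v].
    rewrite /fc !ffunE; case: (unliftP ord0 i) => [j ->|->] /=; last by rewrite fDl.
    by rewrite (ord1 j) /= fDr.
  have := fZ (v ord0) (v (lift ord0 ord0)) (v ord_max).
  rewrite /hdiff !big_ord_recl big_ord0 /fc !ffunE /=.
  (* These equalities bring the indices in ['I_3] to the three forms at which [fZ] was
     instantiated. *)
  have -> : lift ord_max ord0 = ord0 :> 'I_3 by apply: val_inj.
  have -> : lift ord0 ord_max = ord_max :> 'I_3 by apply: val_inj.
  have -> : lift ord0 (lift ord0 ord0) = ord_max :> 'I_3 by apply: val_inj.
  have -> : lift ord_max ord_max = lift ord0 ord0 :> 'I_3 by apply: val_inj.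
  have -> : lift ord_max (lift ord0 ord0) = lift ord0 ord0 :> 'I_3 by apply: val_inj.
  rewrite /bump addr0 !exprS !expr0 !mulr1 !mulN1r !opprK !mulN1r !mul1r.
  by rewrite !addrA => ->.
have /asboolP[g gM fcE] : HCocycle fcP \in @hcoboundary_pred A 2.
  (* A difference is a coboundary exactly when the two classes agree; here the second class is that
     of 0. *)
  rewrite -[HCocycle _]subr0 Quotient.idealrBE; apply/eqP.
  exact: etrans (HH2_0 _) (esym (HH2_0 _)).
pose g1 a := g [ffun=> a].
have g1B : zmod_morphism g1.
  have g1D a b : g1 (a + b) = g1 a + g1 b.
    have gE x : hupd [ffun=> 0] ord0 x = [ffun=> x] :> {ffun 'I_1 -> A}.
      by apply/ffunP => j; rewrite !ffunE (ord1 j) eqxx.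
    by have := gM [ffun=> 0] ord0 a b; rewrite !gE.
  by move=> a b; apply: (addIr (g1 b)); rewrite -g1D !subrK.
pose g1E : endo A := HB.pack g1 (GRing.isZmodMorphism.Build _ _ g1 g1B).
exists g1E => a b.
have := fcE [ffun i => if i == ord0 then a else b].
rewrite /hdiff big_ord_recl big_ord0 /= /fc !ffunE /= => ->.
rewrite addr0 expr1 sqrrN expr1n mulN1r mul1r /= /g1.
by congr (_ * g _ - g _ + g _ * _); apply/ffunP => j; rewrite (ord1 j) !ffunE.
Qed.

Definition multiplicative_mod n F : Prop :=
  forall k, (k < n)%N -> forall a b : A, F k (a * b) = psmul (F^~ a) (F^~ b) k.

Lemma obstruction_cocycle n F (E := fun a b k => psmul (F^~ a) (F^~ b) k - F k (a * b)) :
    F 0%N = 1 -> multiplicative_mod n F -> forall a b c,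
  a * E b c n - E (a * b) c n + E a (b * c) n - E a b n * c = 0.
Proof.
move=> F0 Fmul a b c.
have E0 x y k : (k < n)%N -> E x y k = 0.
  by move=> ltkn; rewrite /E Fmul ?subrr.
have -> : a * E b c n = psmul (F^~ a) (E b c) n.
  by rewrite psmul_vanishr ?F0 // => k; apply: E0.
have -> : E a b n * c = psmul (E a b) (F^~ c) n.
  by rewrite psmul_vanishl ?F0 // => k; apply: E0.
(* With associativity for series and in [A], the expanded terms cancel in pairs. *)
rewrite /E psmulBr psmulBl psmulA mulrA.
by rewrite opprB [X in X - _]addrAC !addrA !subrK subrr.
Qed.

Lemma multiplicative_mod_step n F : (forall x : HH A 2, x = 0) ->
    F 0%N = 1 -> multiplicative_mod n.+1 F ->
  exists G, (forall k, k != n.+1 -> G k = F k) /\ multiplicative_mod n.+2 G.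
Proof.
move=> HH2_0 F0 Fmul.
pose E a b := psmul (F^~ a) (F^~ b) n.+1 - F n.+1 (a * b).
have [|||g gE] := @HH2_vanish E HH2_0.
- move=> a a' b; rewrite /E mulrDl raddfD opprD addrACA; congr (_ + _).
  by rewrite /psmul -big_split /=; apply: eq_bigr => i _; rewrite raddfD mulrDl.
- move=> a b b'; rewrite /E mulrDr raddfD opprD addrACA; congr (_ + _).
  by rewrite /psmul -big_split /=; apply: eq_bigr => i _; rewrite raddfD mulrDr.
- exact: obstruction_cocycle.
(* As the constant term stays 1, this changes the defect [E a b] by minus the coboundary of [g],
   that is, by [- E a b]. *)
pose G k := if k == n.+1 then F n.+1 - g else F k.
have GF k : k != n.+1 -> G k = F k by rewrite /G => /negPf ->.
exists G; split=> // k; rewrite ltnS leq_eqVlt => /predU1P[->|ltkn] a b; last first.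
  rewrite GF ?ltn_eqF // Fmul //; apply: eq_psmul => j lejk; rewrite GF //;
    by rewrite ltn_eqF // (leq_ltn_trans lejk).
rewrite psmul_recl_recr.
rewrite (eq_bigr (fun i : 'I_n => F i.+1 a * F (n - i)%N b)) => [|i _]; last first.
  by rewrite !GF // ltn_eqF // ltnS ?leq_subr.
have /eqP := gE a b; rewrite /E psmul_recl_recr subr_eq => /eqP.
rewrite (GF 0%N) // F0 /G eqxx !endoDE !endoNE mulrBr mulrBl !endo1E => FE.
rewrite [X in _ = X + _]addrAC [RHS]addrACA -opprD FE.
by rewrite [X in X + F _ _]addrAC -[X in _ = X - _]addrA [RHS]addrC addKr addrC.
Qed.

Lemma formal_automorphism_extend n F : (forall x : HH A 2, x = 0) ->
    F 0%N = 1 -> multiplicative_mod n.+1 F ->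
  exists Phi, formal_automorphism Phi /\ forall i, (i <= n)%N -> Phi i = F i.
Proof.
move=> HH2_0 F0 Fmul.
(* The hypotheses sit under the existential so that [choice] yields a total function; [F] is a dummy
   value where they fail. *)
have step_ex (x : nat * (nat -> endo A)) : exists G,
    x.2 0%N = 1 -> multiplicative_mod x.1.+1 x.2 ->
    (forall k, k != x.1.+1 -> G k = x.2 k) /\ multiplicative_mod x.1.+2 G.
  case: (pselect (x.2 0%N = 1 /\ multiplicative_mod x.1.+1 x.2)) => [[x0 xmul]|nx].
    by have [G GP] := multiplicative_mod_step HH2_0 x0 xmul; exists G.
  by exists F => x0 xmul; case: nx.
have [step stepP] := choice step_ex.
pose S := fix S k := if k is j.+1 then step ((n + j)%N, S j) else F.
have SP k : S k 0%N = 1 /\ multiplicative_mod (n + k).+1 (S k).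
  elim: k => [|k [Sk0 Skmul]]; first by rewrite addn0.
  have [agree mul] := stepP ((n + k)%N, S k) Sk0 Skmul.
  by rewrite addnS; split=> //; rewrite /= agree.
have S_agree k j : (j <= n + k)%N -> S k.+1 j = S k j.
  move=> lejk; have [Sk0 Skmul] := SP k.
  have [agree _] := stepP ((n + k)%N, S k) Sk0 Skmul.
  by rewrite /= agree // ltn_eqF // ltnS.
have S_stable k d j : (j <= n + k)%N -> S (k + d)%N j = S k j.
  move=> lejk; elim: d => [|d IHd]; first by rewrite addn0.
  by rewrite addnS S_agree // addnA (leq_trans lejk) ?leq_addr.
(* Diagonal limit: coefficient [i] is constant from stage [i] on, and stage [k] is already
   multiplicative in degree [k]. *)
exists (fun i => S i i); split; last by move=> i lein; rewrite (S_stable 0%N) ?addn0.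
split=> // a b; apply/funext => k; have [_ Skmul] := SP k.
rewrite Skmul ?ltnS ?leq_addl //; apply: eq_psmul => j lejk;
  by rewrite -(subnKC lejk) S_stable ?leq_addl.
Qed.

End Obstruction.

Theorem corollary4p4 (A : sAlgType) (m : nat) (m_gt0 : (0 < m)%N)
    (phi : endo A) (phi_der : derivation phi)
    (HH2_0 : forall x : HH A 2, x = 0) :
  exists Phi : nat -> endo A,
    [/\ formal_automorphism Phi,
        forall i : nat, (0 < i < m)%N -> Phi i = 0
      & Phi m = phi].
Proof.
pose F i : endo A := if i == 0%N then 1 else if i == m then phi else 0.
have Fmul : multiplicative_mod m.+1 F.
  case=> [_ a b|k]; first by rewrite /psmul big_ord1.
  (* The middle terms vanish, their left index being strictly between 0 and [m]. What remains is the
     Leibniz rule in degree [m] and [0 = 0] below. *)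
  rewrite ltnS => lekm a b; rewrite psmul_recl_recr big1 ?addr0 => [|i _]; last first.
    rewrite [F i.+1]/F /= ltn_eqF ?mul0r //.
    by rewrite (leq_trans _ lekm) // ltnS.
  rewrite /F /=; case: eqP => [_|_]; first exact: phi_der.
  by rewrite !endo0E mulr0 mul0r addr0.
have [Phi [PhiP PhiF]] := formal_automorphism_extend HH2_0 erefl Fmul.
exists Phi; split=> // [i /andP[i_gt0 ltim]|].
  by rewrite PhiF ?(ltnW ltim) // /F gtn_eqF // ltn_eqF.
by rewrite PhiF // /F eqxx gtn_eqF.
Qed.
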